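(* Let $k\geq 3$ and consider the Riemannian product $M^n\times\mathbb{R}^k$, whose points are denoted $(p,t,s)$ with $p\in M$, $t\in\mathbb{R}^{k-1}$, $s\in\mathbb{R}$, endowed with a product weight $e^{\psi(p,t,s)}:=e^{h(p)}\,e^{v(t)}$, where $h$ is a $C^1$ function on $M$ and $v(t)=\delta(|t|)$ for some non-decreasing $C^1$ function $\delta:[0,+\infty)\to\mathbb{R}$ with $\delta'(0)=0$. Let $\rho(p,t,s):=|t|^2-s^2$. If $\Sigma\subset M\times\mathbb{R}^k$ is a two-sided, compact and connected $\psi$-minimal hypersurface such that $\partial\Sigma\subset\{\rho\leq r^2\}$ for some $r\geq 0$, then $\Sigma\subset\{\rho\leq r^2\}$.
   Context: $M^n$ is a connected oriented $n$-dimensional Riemannian manifold, possibly with smooth boundary. For a two-sided smooth hypersurface $\Sigma$ (possibly with smooth boundary $\partial\Sigma$) with unit normal $N$, the $\psi$-mean curvature is $H_\psi:=-\operatorname{div}_\Sigma N-\langle\nabla\psi,N\rangle$, and $\Sigma$ is $\psi$-minimal if $H_\psi=0$ on $\Sigma$. *)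

(* Defs.v *)
(* Built on MathComp and MathComp-Analysis, over an arbitrary R : realType. *)
From HB Require Import structures.
From mathcomp Require Import all_boot all_order all_algebra.
From mathcomp Require Import all_classical all_reals all_analysis.
Import Order.TTheory GRing.Theory Num.Theory.
Import numFieldNormedType.Exports.

Set Implicit Arguments.
Unset Strict Implicit.
Unset Printing Implicit Defensive.

Local Open Scope classical_set_scope.
Local Open Scope ring_scope.

(** Calculus on sets that are locally a half-space.

   [dquot_within A f v x] is the filter of difference quotients of [f] at [x]
   in the direction [v], restricted to increments that stay in [A].  If [A] is
   open the restriction has no effect and [dwithin] is the usual ['D_v f x]; at
   a boundary point of a half-space (or of an interval) it is the one-sided
   derivative.  All sets [A] below are relatively open in a half-space or in
   an interval, so 0 is a limit point of the admissible increments for every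
   [v]. *)
Definition dquot_within (R : realType) (V : normedModType R) (A : set V)
    (f : V -> R) (v x : V) : set_system R :=
  (fun h : R => h^-1 * (f (h *: v + x) - f x))
    @ within [set h : R | A (h *: v + x)] 0^'.

Definition dwithin (R : realType) (V : normedModType R) (A : set V)
    (f : V -> R) (v x : V) : R := lim (dquot_within A f v x).

(* Class C^k on A, up to the boundary; V is always finite-dimensional here.  On
   the sets used below, being C^k for all k in this sense is the same as having
   local smooth extensions across the boundary (Whitney, Seeley). *)
Fixpoint Ck (R : realType) (V : normedModType R) (k : nat) (A : set V)
    (f : V -> R) : Prop :=
  {within A, continuous f} /\
  match k with
  | 0%N => True
  | k'.+1 => forall v : V,
      (forall x, A x -> cvg (dquot_within A f v x)) /\ Ck k' A (dwithin A f v)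
  end.

Definition smooth (R : realType) (V : normedModType R) (A : set V)
    (f : V -> R) : Prop := forall k, Ck k A f.

Definition smooth_map (R : realType) (V : normedModType R) (m : nat)
    (A : set V) (f : V -> 'rV[R]_m) : Prop :=
  forall j, smooth A (fun x => f x 0 j).

(* Vectors are rows: row [a] of [jac A f x] is the partial derivative of [f] in
   the [a]-th coordinate, so that the differential of [f] is [v *m jac A f x]. *)
Definition jac (R : realType) (d m : nat) (A : set 'rV[R]_d)
    (f : 'rV[R]_d -> 'rV[R]_m) (x : 'rV[R]_d) : 'M[R]_(d, m) :=
  \matrix_(a, c) dwithin A (fun y => f y 0 c) (delta_mx 0 a) x.

(* The Euclidean norm (the library norm on ['rV_n] is the sup norm). *)
Definition enorm (R : realType) (n : nat) (x : 'rV[R]_n) : R :=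
  Num.sqrt (\sum_j x 0 j ^+ 2).

(* The local models: R^n if [b = false], and the closed half-space on which the
   coordinate of index 0 is nonnegative if [b = true]. *)
Definition model (R : realType) (n : nat) (b : bool) : set 'rV[R]_n :=
  [set x | b -> forall j : 'I_n, val j = 0%N -> 0 <= x 0 j].

Definition model_bd (R : realType) (n : nat) : set 'rV[R]_n :=
  [set x | exists2 j : 'I_n, val j = 0%N & x 0 j = 0].

Definition model_open (R : realType) (n : nat) (b : bool) (D : set 'rV[R]_n) :
    Prop :=
  exists2 O : set 'rV[R]_n, open O & D = O `&` @model R n b.

(** Riemannian manifolds, presented by an atlas.

   The record only carries the data; the axioms are in [riemannian_manifold].
   The values of [coord i] outside [cdom i], and of [param i] and [metric i]
   outside [cimage i], are irrelevant.  [metric i x] is the Gram matrix of the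
   coordinate frame of the chart [i] at the point with coordinates [x]. *)
Record riem_atlas (R : realType) (M : Type) (n : nat) := RiemAtlas {
  chart : Type;
  cdom : chart -> set M;
  coord : chart -> M -> 'rV[R]_n;
  param : chart -> 'rV[R]_n -> M;
  metric : chart -> 'rV[R]_n -> 'M[R]_n }.

Section Atlas.
Variables (R : realType) (M : Type) (n : nat) (A : riem_atlas R M n).
Implicit Types i j : chart A.

Definition cimage i : set 'rV[R]_n := coord i @` cdom i.

Definition cimage2 i j : set 'rV[R]_n := coord i @` (cdom i `&` cdom j).

Definition transition i j : 'rV[R]_n -> 'rV[R]_n := coord j \o param i.

Definition trans_jac i j (x : 'rV[R]_n) : 'M[R]_n :=
  jac (cimage2 i j) (transition i j) x.

Definition inner i (x v w : 'rV[R]_n) : R := (v *m metric i x *m w^T) 0 0.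

(* An orientation gives each chart a sign (rather than asking all transition
   maps to preserve orientation), so that the half-space charts of a
   1-manifold with boundary, and 0-manifolds, need no special treatment. *)
Definition orientation (sgn : chart A -> bool) : Prop :=
  forall i j x, cimage2 i j x ->
    0 < (-1) ^+ (sgn i (+) sgn j) * \det (trans_jac i j x).

(* dmetric i x e f l is the derivative of the (f, l) metric coefficient in the
   e-th coordinate. *)
Definition dmetric i (x : 'rV[R]_n) (e f l : 'I_n) : R :=
  dwithin (cimage i) (fun y => metric i y f l) (delta_mx 0 e) x.

Definition christoffel i (x : 'rV[R]_n) (c e f : 'I_n) : R :=
  2^-1 * \sum_l invmx (metric i x) c l *
    (dmetric i x e f l + dmetric i x f e l - dmetric i x l e f).

Definition Ck_fun (k : nat) (f : M -> R) : Prop :=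
  forall i, Ck k (cimage i) (f \o param i).

Definition gradient (f : M -> R) i (x : 'rV[R]_n) : 'rV[R]_n :=
  (\row_c dwithin (cimage i) (f \o param i) (delta_mx 0 c) x)
    *m invmx (metric i x).

End Atlas.

(* Smooth Riemannian manifold with (possibly empty) smooth boundary. *)
Definition riemannian_manifold (R : realType) (M : topologicalType) (n : nat)
    (A : riem_atlas R M n) : Prop :=
  [/\ hausdorff_space M /\ @second_countable M,
      forall p : M, exists i : chart A, cdom i p,
      forall i : chart A,
        [/\ open (cdom i),
            exists b, model_open b (cimage i),
            forall p, cdom i p -> param i (coord i p) = p,
            {within cdom i, continuous (coord i)} &
            {within cimage i, continuous (param i)}],
      forall i : chart A,
        (forall a c, smooth (cimage i) (fun x => metric i x a c)) /\
        (forall x, cimage i x ->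
           (metric i x)^T = metric i x /\
           forall v, v != 0 -> 0 < inner i x v v) &
      forall i j : chart A,
        smooth_map (cimage2 i j) (transition i j) /\
        (forall x, cimage2 i j x ->
           metric i x =
             trans_jac i j x *m metric j (transition i j x)
               *m (trans_jac i j x)^T)].

Definition prod_atlas (R : realType) (M N : Type) (m n : nat)
    (A : riem_atlas R M m) (B : riem_atlas R N n) :
    riem_atlas R (M * N) (m + n) :=
  {| chart := (chart A * chart B)%type;
     cdom := fun ij => cdom ij.1 `*` cdom ij.2;
     coord := fun ij p => row_mx (coord ij.1 p.1) (coord ij.2 p.2);
     param := fun ij x => (param ij.1 (lsubmx x), param ij.2 (rsubmx x));
     metric := fun ij x =>
       block_mx (metric ij.1 (lsubmx x)) 0 0 (metric ij.2 (rsubmx x)) |}.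

(* Euclidean space R^l x R, with a single global chart. *)
Definition eucl_atlas (R : realType) (l : nat) :
    riem_atlas R ('rV[R]_l * R) (l + 1) :=
  {| chart := unit;
     cdom := fun _ => setT;
     coord := fun _ q => row_mx q.1 (const_mx q.2);
     param := fun _ x => (lsubmx x, rsubmx x 0 0);
     metric := fun _ _ => 1%:M |}.

(** Embedded hypersurfaces with (possibly empty) boundary.

   A patch of [Sig] is a smooth immersion [X] of a relatively open subset [D]
   of R^(m-1) or of a half-space of it, which is a homeomorphism onto a
   relatively open subset of [Sig]. *)
Section Hypersurface.
Variables (R : realType) (M : topologicalType) (m : nat).
Variable A : riem_atlas R M m.
Implicit Types (Sig : set M) (i j : chart A) (D : set 'rV[R]_m.-1)
  (X : 'rV[R]_m.-1 -> M) (u : 'rV[R]_m.-1) (nu : chart A -> M -> 'rV[R]_m).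

(* The part of the domain of a patch that is mapped into the chart i. *)
Definition pdom i D X : set 'rV[R]_m.-1 := D `&` X @^-1` cdom i.

(* Row a holds the coordinates of the a-th tangent vector of the patch. *)
Definition tangent i D X u : 'M[R]_(m.-1, m) :=
  jac (pdom i D X) (coord i \o X) u.

Definition is_patch Sig (b : bool) D X : Prop :=
  [/\ model_open b D,
      exists2 W : set M, open W & X @` D = Sig `&` W,
      {within D, continuous X},
      exists2 Y : M -> 'rV[R]_m.-1,
        {within X @` D, continuous Y} & forall u, D u -> Y (X u) = u &
      forall i,
        smooth_map (pdom i D X) (coord i \o X) /\
        (forall u, pdom i D X u -> row_free (tangent i D X u))].

Definition hypersurface Sig : Prop :=
  forall p, Sig p -> exists b D X, is_patch Sig b D X /\ (X @` D) p.

Definition hboundary Sig : set M :=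
  [set p | exists D X, is_patch Sig true D X /\
             (X @` (D `&` @model_bd R m.-1)) p].

(* [nu i p] is the coordinate vector of N(p) in the chart [i]; the first clause
   says that these vectors represent one tangent vector of the ambient
   manifold.  A hypersurface is two-sided iff it has such a field. *)
Definition unit_normal Sig nu : Prop :=
  [/\ forall i j p, Sig p -> cdom i p -> cdom j p ->
        nu j p = nu i p *m trans_jac i j (coord i p),
      forall i p, Sig p -> cdom i p ->
        inner i (coord i p) (nu i p) (nu i p) = 1 &
      forall b D X, is_patch Sig b D X -> forall i,
        smooth_map (pdom i D X) (nu i \o X) /\
        (forall u, pdom i D X u -> forall a,
           inner i (coord i (X u)) (row a (tangent i D X u)) (nu i (X u)) = 0)].

(* Row a is the Levi-Civita covariant derivative of N along the a-th tangent
   vector of the patch. *)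
Definition cov_normal nu i D X u : 'M[R]_(m.-1, m) :=
  \matrix_(a, c)
    (jac (pdom i D X) (nu i \o X) u a c +
     \sum_e \sum_f christoffel i (coord i (X u)) c e f
                     * tangent i D X u a e * nu i (X u) 0 f).

(* The trace over the tangent space of (v, w) |-> <nabla_v N, w>, computed in
   the basis of tangent vectors of the patch, with Gram matrix G: this is
   tr (G^-1 B), the sum of <nabla_{e_a} N, e_a> over an orthonormal basis. *)
Definition div_normal nu i D X u : R :=
  let J := tangent i D X u in
  let g := metric i (coord i (X u)) in
  \tr (invmx (J *m g *m J^T) *m (cov_normal nu i D X u *m g *m J^T)).

(* H_psi at the point X u, computed in the patch (D, X) and in the chart i. *)
Definition psi_mean_curvature (psi : M -> R) nu i D X u : R :=
  - div_normal nu i D X u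
  - inner i (coord i (X u)) (gradient psi i (coord i (X u))) (nu i (X u)).

Definition psi_minimal (psi : M -> R) Sig nu : Prop :=
  forall b D X, is_patch Sig b D X ->
  forall i u, pdom i D X u -> psi_mean_curvature psi nu i D X u = 0.

End Hypersurface.

(* Main.v *)
(** Write f = (1 + eps)|t|^2 - s^2 = rho + eps|t|^2 with eps > 0.  For a function
   of (t, s), the drift Laplacian of a psi-minimal hypersurface with normal N is
   the trace of the Euclidean Hessian over the tangent space plus the derivative
   along grad psi.  For f this is at least
     2((1 + eps)(k - 1) - 1) - 2((1 + eps)|N_t|^2 - N_s^2) + 2(1 + eps)|t| delta'(|t|),
   which is positive because |N_t| <= 1 and k >= 3.  Hence f has no interior local
   maximum on Sigma, so its maximum over the compact set Sigma is attained on the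
   boundary; letting eps tend to 0 gives the bound on rho.

   No covariant calculus on M is needed: at an interior maximum grad f is normal
   to Sigma.  Either grad f = 0 there, or N has no component along M, and then
   the Christoffel symbols and the derivatives of the metric of M drop out of
   div N. *)

Require Import Defs.
From HB Require Import structures.
From mathcomp Require Import all_boot all_order all_algebra.
From mathcomp Require Import all_classical all_reals all_analysis.
From mathcomp Require Import ring lra.
Import Order.TTheory GRing.Theory Num.Theory.
Import numFieldNormedType.Exports.

Set Implicit Arguments.
Unset Strict Implicit.
Unset Printing Implicit Defensive.

Local Open Scope classical_set_scope.
Local Open Scope ring_scope.

(** * Positive definite matrices *)

Section LinearAlgebra.
Variable R : realType.

Definition quadf (m : nat) (g : 'M[R]_m) (v : 'rV[R]_m) : R :=
  (v *m g *m v^T) 0 0.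

Definition posdef (m : nat) (g : 'M[R]_m) : Prop :=
  g^T = g /\ forall v, v != 0 -> 0 < quadf g v.

Lemma mx11_eq (a b : 'M[R]_1) : a 0 0 = b 0 0 -> a = b.
Proof. by move=> ab; apply/matrixP=> i j; rewrite !ord1. Qed.

Lemma posdef_ge0 m (g : 'M[R]_m) v : posdef g -> 0 <= quadf g v.
Proof.
move=> [_ gp]; have [->|v0] := eqVneq v 0; last exact/ltW/gp.
by rewrite /quadf !mul0mx mxE.
Qed.

Lemma posdef_unit m (g : 'M[R]_m) : posdef g -> g \in unitmx.
Proof.
move=> [_ gp]; rewrite -row_free_unit -kermx_eq0; apply/rowV0P => v.
move/sub_kermxP=> vg; apply/eqP/negP => /negP /gp.
by rewrite /quadf vg mul0mx mxE ltxx.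
Qed.

Lemma posdef_inv m (g : 'M[R]_m) : posdef g -> posdef (invmx g).
Proof.
move=> gp; have gu := posdef_unit gp; have [gs gpos] := gp.
have igs : (invmx g)^T = invmx g by rewrite trmx_inv gs.
split=> // v v0; have w0 : v *m invmx g != 0.
  apply: contraNneq v0 => w0; by rewrite -(mulmxKV gu v) w0 mul0mx.
by move: (gpos _ w0); rewrite /quadf trmx_mul igs mulmxKV // mulmxA.
Qed.

Lemma posdef_congr p m (J : 'M[R]_(p, m)) (g : 'M[R]_m) :
  posdef g -> row_free J -> posdef (J *m g *m J^T).
Proof.
move=> [gs gp] Jf; split=> [|v v0].
  by rewrite !trmx_mul trmxK gs mulmxA.
have w0 : v *m J != 0 by rewrite mulmx_free_eq0.
by move: (gp _ w0); rewrite /quadf trmx_mul !mulmxA.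
Qed.

(** Induction on the size by Schur complement: with pivot [a] and column [b] below it, [S] is again
    positive definite, and a factor [L] of [S] is completed by a first column made of [s] and
    [s^-1 *: b], where [s] is the square root of [a]. *)
Lemma cholesky m (g : 'M[R]_m) : posdef g -> exists L : 'M[R]_m, g = L *m L^T.
Proof.
elim: m g => [|m IH] g [gs gp].
  by exists 0; apply/matrixP => -[].
rewrite -[m.+1]/(1 + m)%N in g gs gp *.
pose a := ulsubmx g 0 0; pose b := dlsubmx g; pose C := drsubmx g.
have ulE : ulsubmx g = a%:M.
  by apply: mx11_eq; rewrite [RHS]mxE eqxx mulr1n.
have urE : ursubmx g = b^T by rewrite /b -[in RHS]gs -trmx_ursub trmxK.
have gE : g = block_mx a%:M b^T b C by rewrite -ulE -urE submxK.
have CT : C^T = C by rewrite /C trmx_drsub gs.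
have a0 : 0 < a.
  have := gp (row_mx 1 0); rewrite row_mx_eq0 oner_eq0 => /(_ isT).
  rewrite /quadf gE mul_row_block tr_row_mx mul_row_col !mul0mx !addr0 trmx0.
  by rewrite mulmx0 addr0 mul1mx trmx1 mulmx1 mxE eqxx mulr1n.
pose S := C - a^-1 *: (b *m b^T).
have Sp : posdef S.
  split=> [|w w0]; first by rewrite /S linearB linearZ /= trmx_mul trmxK CT.
  (* For fixed [w] this first coordinate minimizes the form, and the minimum is [quadf S w]. *)
  have := gp (row_mx (- a^-1 *: (w *m b)) w).
  rewrite row_mx_eq0 negb_and w0 orbT => /(_ isT).
  rewrite /quadf gE mul_row_block tr_row_mx mul_row_col /S.
  rewrite scalar_mxC mul_scalar_mx scalerA mulrN mulfV ?gt_eqF // scaleN1r.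
  by rewrite addNr mul0mx add0r mulmxBr -scalemxAl -scalemxAr mulmxA scaleNr addrC.
have [L LE] := IH _ Sp.
pose s := Num.sqrt a; have s0 : s != 0 by rewrite gt_eqF // sqrtr_gt0.
have ss : s * s = a by rewrite -expr2 sqr_sqrtr // ltW.
exists (block_mx s%:M 0 (s^-1 *: b) L).
rewrite tr_block_mx mulmx_block gE !trmx0 !mulmx0 !mul0mx !addr0 -LE.
rewrite tr_scalar_mx -scalar_mxM ss linearZ /= mul_scalar_mx scalerA mulfV //.
rewrite scale1r mul_mx_scalar scalerA mulfV // scale1r.
congr block_mx.
rewrite -scalemxAl -scalemxAr scalerA -invfM ss /S.
by rewrite addrC subrK.
Qed.

(** With [K = L L^T], cyclicity turns the trace into that of [L^T H L], whose diagonal entries are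
    the values of [quadf H] on the columns of [L]. *)
Lemma posdef_trace_le0 m (K H : 'M[R]_m) : posdef K ->
  (forall v, quadf H v <= 0) -> \tr (K *m H) <= 0.
Proof.
move=> /cholesky [L ->] Hle; rewrite -mulmxA mxtrace_mulC /mxtrace.
apply: sumr_le0 => i _.
suff -> : (L^T *m H *m L) i i = quadf H (row i L^T) by [].
rewrite /quadf -row_mul tr_row trmxK [LHS]mxE [RHS]mxE.
by apply: eq_bigr => j _; rewrite [row _ _ _ _]mxE [col _ _ _ _]mxE.
Qed.

(** The rows of [J] together with [nu] form a square matrix [P] for which [P g P^T] is block
    diagonal, and inverting this Gram matrix gives [invmx g]. The inverse metric is thus split into
    a tangential and a normal part. *)
Lemma normal_completeness p m (g : 'M[R]_m) (J : 'M[R]_(p, m)) (nu : 'rV[R]_m) :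
  m = (p + 1)%N -> posdef g -> row_free J -> J *m g *m nu^T = 0 ->
  quadf g nu = 1 ->
  invmx g = J^T *m invmx (J *m g *m J^T) *m J + nu^T *m nu.
Proof.
move=> e; subst m => gp Jf Jnu nu1.
have [gs _] := gp.
have Gu := posdef_unit (posdef_congr gp Jf).
pose P := col_mx J nu; pose D := block_mx (invmx (J *m g *m J^T)) 0 0 (1%:M : 'M[R]_1).
have nuJ : nu *m g *m J^T = 0.
  by apply: trmx_inj; rewrite !trmx_mul trmxK gs mulmxA Jnu trmx0.
have nu11 : nu *m g *m nu^T = 1%:M.
  by apply: mx11_eq; rewrite [LHS]nu1 mxE eqxx.
have E : P *m (g *m P^T *m D) = 1%:M.
  rewrite /P /D !mulmxA tr_col_mx mul_col_mx mul_col_row Jnu nuJ nu11.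
  by rewrite mulmx_block !mulmx0 !mul0mx mulmx1 !addr0 !add0r mulmxV // -scalar_mx_block.
(* A right inverse of the square matrix [P] is also a left inverse; this is where [m = p + 1]
   counts. *)
have E2 : g *m (P^T *m D *m P) = 1%:M by rewrite -(mulmx1C E) !mulmxA.
have -> : invmx g = P^T *m D *m P.
  by rewrite -[RHS](mulKmx (posdef_unit gp)) E2 mulmx1.
rewrite /P /D tr_col_mx mul_row_block !mulmx0 addr0 add0r mulmx1 mul_row_col.
by [].
Qed.

(** When the inverse metric is applied to [g F^T], its tangential part gives 0 and its normal part
    gives [nu] times the inner product of [nu] and [F]. *)
Lemma normal_unique p m (g : 'M[R]_m) (J : 'M[R]_(p, m)) (nu F : 'rV[R]_m) :
  m = (p + 1)%N -> posdef g -> row_free J -> J *m g *m nu^T = 0 ->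
  quadf g nu = 1 -> J *m g *m F^T = 0 ->
  exists lam, F = lam *: nu.
Proof.
move=> e gp Jf Jnu nu1 JF; exists ((nu *m g *m F^T) 0 0).
set c := (_ 0 0); apply: trmx_inj; rewrite linearZ /= -[LHS](mulKmx (posdef_unit gp)).
rewrite (normal_completeness e gp Jf Jnu nu1) mulmxDl -!mulmxA.
rewrite (_ : J *m (g *m F^T) = 0); last by rewrite mulmxA.
rewrite !mulmx0 add0r.
have -> : nu *m (g *m F^T) = c%:M.
  by apply: mx11_eq; rewrite [RHS]mxE eqxx mulr1n mulmxA.
by rewrite mul_mx_scalar.
Qed.

End LinearAlgebra.

(** * Directional derivatives *)

Section Calculus.
Variable R : realType.

Lemma within_self T (F : set_system T) (S : set T) :
  Filter F -> F S -> within S F = F.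
Proof.
move=> FF FS; rewrite eqEsubset; split=> P; rewrite /within /= => FP.
  by apply: filterS2 FS FP => x Sx; apply.
by apply: filterS FP => x Px _.
Qed.

Lemma line_cvg (V : normedModType R) (v x : V) :
  h *: v + x @[h --> (0 : R)] --> x.
Proof.
have H : continuous (fun h : R => h *: v + x).
  by move=> h; apply: cvgD; [exact: scalel_continuous|exact: cvg_cst].
by have := H 0; rewrite /continuous_at scale0r add0r.
Qed.

Lemma line_near (V : normedModType R) (v x : V) (P : set V) :
  (\forall y \near x, P y) -> \forall h \near (0 : R), P (h *: v + x).
Proof. exact: line_cvg. Qed.

(** Once all small increments stay in [A], the restricted filter is the ordinary punctured one, so
    that [dwithin] can be exchanged for the two-sided derivative. *)
Lemma dquot_within_nbhs (V : normedModType R) (A : set V) (f : V -> R) v x :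
  (\forall h \near (0 : R), A (h *: v + x)) ->
  dquot_within A f v x = (h^-1 * (f (h *: v + x) - f x)) @[h --> (0 : R)^'].
Proof.
move=> Av; rewrite /dquot_within within_self //.
by rewrite /dnbhs /within /=; apply: filterS Av => h Ah _.
Qed.

Lemma dquot_within_is_derive (V : normedModType R) (A : set V) (f : V -> R) v x :
  (\forall h \near (0 : R), A (h *: v + x)) -> cvg (dquot_within A f v x) ->
  is_derive x v f (dwithin A f v x).
Proof.
by move=> Av fc; split; rewrite /derivable /derive /dwithin;
  move: fc; rewrite dquot_within_nbhs.
Qed.

Lemma is_derive_dwithin (V : normedModType R) (A : set V) (f : V -> R) v x d :
  (\forall h \near (0 : R), A (h *: v + x)) -> is_derive x v f d ->
  dwithin A f v x = d.
Proof.
by move=> Av [fc <-]; rewrite /dwithin dquot_within_nbhs.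
Qed.

Lemma Ck_is_derive (V : normedModType R) k (A : set V) (f : V -> R) v x :
  Ck k.+1 A f -> A° x -> is_derive x v f (dwithin A f v x).
Proof.
move=> [_ /(_ v) [fc _]] Ax; apply: dquot_within_is_derive.
  exact: line_near.
by apply: fc; exact: interior_subset.
Qed.

Lemma Ck_continuous (V : normedModType R) k (A : set V) (f : V -> R) x :
  Ck k A f -> A° x -> {for x, continuous f}.
Proof.
move=> Cf Ax; have {Cf} : {within A, continuous f} by case: k Cf => [|k] [].
move/subspace_continuousP/(_ x (interior_subset Ax)).
by rewrite within_interior.
Qed.

(** Both difference quotients are the same function of [h]. This opens directional derivatives to
    the one-variable chain rule and mean value theorem. *)
Lemma is_derive_line (V : normedModType R) (f : V -> R) (v x : V) (s d : R) :
  is_derive (s *: v + x) v f d <-> is_derive s 1 (fun r : R => f (r *: v + x)) d.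
Proof.
suff E : (fun h : R => h^-1 *: ((f \o shift (s *: v + x)) (h *: v) - f (s *: v + x))) =
  (fun h : R =>
     h^-1 *: (((fun r : R => f (r *: v + x)) \o shift s) (h *: 1) - f (s *: v + x))).
  by split=> -[]; rewrite /derivable /derive => fc fd; split;
    move: fc fd; rewrite /derivable /derive E.
apply/funext => h /=; rewrite [_%:A]mulr1 scalerDl addrA //.
Qed.

Lemma is_derive_scaledir (V : normedModType R) (f : V -> R) (v x : V) (c d : R) :
  is_derive x v f d -> is_derive x (c *: v) f (c * d).
Proof.
move=> fd; rewrite -[x]add0r -[X in X + x](scale0r (c *: v)).
apply/is_derive_line.
have {fd} : is_derive (0 *: v + x) v f d by rewrite scale0r add0r.
move/is_derive_line => fd.
have lc : is_derive (0 : R) 1 (fun r : R => c * r) c.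
  have := is_deriveZ c (is_derive_id (0 : R) (1 : R)).
  by rewrite [c *: 1]mulr1.
have fd' : is_derive (c * 0) 1 (fun r : R => f (r *: v + x)) d by rewrite mulr0.
rewrite mulrC.
have := @is_derive1_comp _ _ _ _ _ _ fd' lc.
by apply: near_eq_is_derive; near=> r; rewrite /= scalerA mulrC.
Unshelve. all: by end_near. Qed.

(** The increment along [v + w] is an increment along [v] followed by one along [w]. By the mean
    value theorem the second equals [h] times [Dw] at a point of the segment, and that point tends
    to [x]. *)
Lemma is_derive_adddir (V : normedModType R) (f Dw : V -> R) (v w x : V) (d : R) :
  (\forall y \near x, is_derive y w f (Dw y)) -> {for x, continuous Dw} ->
  is_derive x v f d -> is_derive x (v + w) f (d + Dw x).
Proof.
move=> fw cDw fv.
suff H : h^-1 *: (f (h *: (v + w) + x) - f (h *: v + x)) @[h --> (0 : R)^'] --> Dw x.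
  have fv' : h^-1 *: (f (h *: v + x) - f x) @[h --> (0 : R)^'] --> d.
    by case: fv => fc <-.
  have : h^-1 *: (f (h *: (v + w) + x) - f x) @[h --> (0 : R)^'] --> d + Dw x.
    rewrite (addrC d) (_ : (fun h : R => _) =
      (fun h : R => h^-1 *: (f (h *: (v + w) + x) - f (h *: v + x))) \+
      (fun h : R => h^-1 *: (f (h *: v + x) - f x))); first exact: cvgD.
    by apply/funext => h /=; rewrite -scalerDr subrKA.
  by move=> fvw; split; [apply/cvg_ex; exists (d + Dw x)|exact: cvg_lim fvw].
apply/cvgrPdist_lt => e e0.
have : \forall y \near x, is_derive y w f (Dw y) /\ `|Dw x - Dw y| < e.
  by apply: filterS2 fw ((cvgrPdist_lt _ _).1 cDw _ e0) => y ? ?; split.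
case/nbhs_ballP => r /= r0 rP.
(* For small [h] the whole segment from [h v + x] to [h (v + w) + x] lies in the ball; the 1 in [N]
   keeps [r / N] meaningful when [v] and [w] vanish. *)
have : \forall h \near (0 : R), forall s : R, s \in `[0, 1]%R ->
    ball x r (s *: (h *: w) + (h *: v + x)).
  pose N := `|v| + `|w| + 1.
  have N0 : 0 < N by rewrite ltr_wpDl // addr_ge0.
  have : \forall h \near (0 : R), `|h| < r / N by apply: nbhs0_lt; rewrite divr_gt0.
  apply: filterS => h hN s; rewrite in_itv /= => /andP[s0 s1].
  rewrite -ball_normE /= addrA opprD addrCA subrr addr0 normrN.
  rewrite (le_lt_trans (ler_normD _ _)) // !normrZ.
  rewrite (@le_lt_trans _ _ (`|h| * N)) ?ltr_pdivlMr -?ltr_pdivlMr //.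
  rewrite /N mulrDr mulrDr mulr1 (ger0_norm s0).
  have : s * (`|h| * `|w|) <= `|h| * `|w| by rewrite ler_piMl // mulr_ge0.
  have := normr_ge0 h; lra.
move=> near_ball; near=> h.
have h0 : h != 0 by near: h; exact: nbhs_dnbhs_neq.
have hB : forall s : R, s \in `[0, 1]%R -> ball x r (s *: (h *: w) + (h *: v + x)).
  near: h; apply: cvg_within; exact: near_ball.
pose g (s : R) := f (s *: (h *: w) + (h *: v + x)).
pose dg (s : R) := h * Dw (s *: (h *: w) + (h *: v + x)).
have gd (s : R) : s \in `[0, 1]%R -> is_derive s 1 g (dg s).
  move=> s01; apply: (is_derive_line f (h *: w) (h *: v + x) s (dg s)).1.
  apply: is_derive_scaledir.
  by have [] := rP _ (hB _ s01).
have gc : {within `[0, 1], continuous g}.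
  apply: derivable_within_continuous => s s01.
  by have [] := gd s s01.
have oo_cc (s : R) : s \in `]0, 1[%R -> s \in `[0, 1]%R.
  by rewrite !in_itv /= => /andP[/ltW -> /ltW ->].
have gd' (s : R) : s \in `]0, 1[%R -> is_derive s 1 g (dg s) by move=> /oo_cc /gd.
have [c c01] := MVT ltr01 gd' gc.
rewrite /g scale1r scale0r add0r subr0 mulr1 addrA -scalerDr (addrC w) => ->.
rewrite /dg [_ *: _]mulKf //.
by have [] := rP _ (hB c (oo_cc _ c01)).
Unshelve. all: by end_near. Qed.

(** [Ck] gives a derivative in each direction separately, without linearity in the direction.
    Continuity of the partial derivatives supplies it, one coordinate being added at a time. *)
Lemma is_derive_row d (f : 'rV[R]_d -> R) (D : 'I_d -> 'rV[R]_d -> R) x v :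
  (forall a, \forall y \near x, is_derive y (delta_mx 0 a) f (D a y)) ->
  (forall a, {for x, continuous (D a)}) ->
  is_derive x v f (\sum_a v 0 a * D a x).
Proof.
move=> fD cD; rewrite [v in is_derive _ v]row_sum_delta.
elim: (index_enum _) => [|a s IH]; first by rewrite !big_nil; exact: is_derive0.
rewrite !big_cons addrC [X in is_derive _ _ _ X]addrC.
apply: (@is_derive_adddir _ f (fun y => v 0 a * D a y)) => //.
  by apply: filterS (fD a) => y; exact: is_derive_scaledir.
by apply: (@continuousM _ _ (fun=> v 0 a)); [exact: cst_continuous|exact: cD].
Qed.

(** The first part is Fermat's rule. If [c] were positive, [dphi] would be positive just to the
    right of 0, and the mean value theorem would give a value of [phi] above [phi 0]. *)
Lemma second_derivative_test (phi dphi : R -> R) (c : R) :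
  (\forall s \near (0 : R), is_derive (s : R) 1 phi (dphi s)) ->
  is_derive (0 : R) 1 dphi c ->
  (\forall s \near (0 : R), phi s <= phi 0) -> dphi 0 = 0 /\ c <= 0.
Proof.
move=> phid dphid phimax.
have : \forall s \near (0 : R), is_derive (s : R) 1 phi (dphi s) /\ phi s <= phi 0.
  by apply: filterS2 phid phimax => s ? ?; split.
case/nbhs_ballP => r /= r0 rP.
have inr (s : R) : s \in `]- r, r[%R -> is_derive s 1 phi (dphi s) /\ phi s <= phi 0.
  by rewrite in_itv /= => sr; apply: rP; rewrite -ball_normE /= sub0r normrN ltr_norml.
have r0itv : (0 : R) \in `]- r, r[%R by rewrite in_itv /= oppr_lt0 r0.
have d0 : dphi 0 = 0.
  have [||_ phiE] := derive1_at_max _ _ r0itv (fun t tr => (inr t tr).2).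
  - by rewrite ge0_cp // ltW.
  - by move=> t /inr [[]].
  by have [[_ <-] _] := inr 0 r0itv.
split=> //; rewrite leNgt; apply/negP => c0.
have : \forall h \near (0 : R)^', 0 < h^-1 * dphi h.
  have [dc dE] := dphid.
  have : h^-1 *: (dphi (h *: 1 + 0) - dphi 0) @[h --> (0 : R)^'] --> c by rewrite -dE.
  move=> /cvgr_gt /(_ 0 c0); apply: filterS => h.
  by rewrite d0 subr0 addr0 [h *: 1]mulr1.
rewrite /dnbhs /within /= => /nbhs_ballP[q /= q0 qP].
pose b := Num.min q r / 2.
have b0 : 0 < b by rewrite divr_gt0 // lt_min q0.
have mq : Num.min q r <= q by rewrite ge_min lexx.
have mr : Num.min q r <= r by rewrite ge_min lexx orbT.
have bq : b < q by rewrite /b; lra.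
have br : b < r by rewrite /b; lra.
have br' (t : R) : 0 <= t -> t <= b -> t \in `]- r, r[%R.
  by move=> t0 tb; rewrite in_itv /= (le_lt_trans tb br) (lt_le_trans _ t0) ?oppr_lt0.
have phid' (t : R) : t \in `[0, b]%R -> is_derive t 1 phi (dphi t).
  by rewrite in_itv /= => /andP[t0 tb]; have [] := inr t (br' t t0 tb).
have pc : {within `[0, b], continuous phi}.
  by apply: derivable_within_continuous => t /phid' [].
have phid'' (t : R) : t \in `]0, b[%R -> is_derive t 1 phi (dphi t).
  move=> t0b; apply: phid'; move: t0b.
  by rewrite !in_itv /= => /andP[/ltW -> /ltW ->].
have [t t0b E] := MVT b0 phid'' pc.
have t0 : 0 < t by rewrite (itvP t0b).
have tb : t < b by rewrite (itvP t0b).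
have dt : 0 < dphi t.
  have := qP t; rewrite -ball_normE /= sub0r normrN gtr0_norm //.
  by move=> /(_ (lt_trans tb bq) (lt0r_neq0 t0)); rewrite pmulr_rgt0 // invr_gt0.
have [_] := inr b (br' b (ltW b0) (lexx b)).
by rewrite -subr_le0 E subr0 leNgt mulr_gt0.
Qed.

(** Since [b x = 0], the difference quotient of the product is [a (h v + x)] times that of [b], so
    continuity of [a] suffices. *)
Lemma is_deriveM_vanish (V : normedModType R) (a b : V -> R) (x v : V) (db : R) :
  {for x, continuous a} -> is_derive x v b db -> b x = 0 ->
  is_derive x v (fun y => a y * b y) (a x * db).
Proof.
move=> ca [bc bE] b0.
have : h^-1 *: (a (h *: v + x) * b (h *: v + x) - a x * b x) @[h --> (0 : R)^']
    --> a x * db.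
  rewrite (_ : (fun h : R => _) = (fun h : R => a (h *: v + x)) \*
      (fun h : R => h^-1 *: (b (h *: v + x) - b x))).
    apply: cvgM; last by rewrite -bE.
    move=> P /ca /(line_near v); rewrite /= /dnbhs /within /=.
    by apply: filterS => h Ph _.
  by apply/funext => h /=; rewrite b0 mulr0 !subr0 /GRing.scale /= mulrCA.
by move=> H; split; [apply/cvg_ex; exists (a x * db)|exact: cvg_lim H].
Qed.

End Calculus.

(** * The trace inequality *)

Section TraceInequality.
Variable R : realType.

(** The trace of [Q] over the tangent space is its full trace minus its value on the unit normal, by
    [normal_completeness]. *)
Lemma tangent_trace p m (g Q : 'M[R]_m) (J : 'M[R]_(p, m)) (nu : 'rV[R]_m) :
  m = (p + 1)%N -> posdef g -> row_free J -> J *m g *m nu^T = 0 ->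
  quadf g nu = 1 ->
  \tr (invmx (J *m g *m J^T) *m (J *m Q *m J^T)) =
    \tr (Q *m invmx g) - quadf Q nu.
Proof.
move=> e gp Jf Jnu nu1; rewrite (normal_completeness e gp Jf Jnu nu1).
rewrite mulmxDr mxtraceD.
have -> : \tr (Q *m (nu^T *m nu)) = quadf Q nu.
  by rewrite mulmxA mxtrace_mulC mulmxA /quadf /mxtrace big_ord1.
rewrite addrK mxtrace_mulC -!mulmxA mxtrace_mulC.
by rewrite !mulmxA.
Qed.

Variables (n l : nat).

(* The coefficients of (1 + eps)|t|^2 - s^2 as a quadratic form in the
   coordinates of a chart of M, followed by t and s. *)
Definition rho_coef (eps : R) : 'rV[R]_(n + (l + 1)) :=
  row_mx 0 (row_mx (const_mx (1 + eps)) (const_mx (- 1))).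

Definition prod_metric (gM : 'M[R]_n) : 'M[R]_(n + (l + 1)) :=
  block_mx gM 0 0 1%:M.

Lemma rho_coefl eps a : rho_coef eps 0 (lshift _ a) = 0.
Proof. by rewrite row_mxEl mxE. Qed.

Lemma rho_coef_t eps j : rho_coef eps 0 (rshift n (lshift 1 j)) = 1 + eps.
Proof. by rewrite row_mxEr row_mxEl mxE. Qed.

Lemma rho_coef_s eps j : rho_coef eps 0 (rshift n (rshift l j)) = - 1.
Proof. by rewrite !row_mxEr mxE. Qed.

Lemma quadf_rho_coef eps (v : 'rV[R]_(n + (l + 1))) :
  quadf (diag_mx (rho_coef eps)) v = \sum_c rho_coef eps 0 c * v 0 c ^+ 2.
Proof.
rewrite /quadf mxE; apply: eq_bigr => c _.
by rewrite mul_mx_diag !mxE mulrAC mulrC expr2.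
Qed.

Lemma prod_metric_posdef gM : posdef gM -> posdef (prod_metric gM).
Proof.
move=> gp; have [gs gpos] := gp; split.
  by rewrite /prod_metric tr_block_mx gs !trmx0 trmx1.
move=> v; rewrite -[v]hsubmxK row_mx_eq0 negb_and => v0.
rewrite /quadf /prod_metric mul_row_block tr_row_mx mul_row_col.
rewrite !mulmx0 addr0 add0r mulmx1 mxE.
have pE : (rsubmx v *m (rsubmx v)^T) 0 0 = \sum_j rsubmx v 0 j ^+ 2.
  by rewrite mxE; apply: eq_bigr => j _; rewrite !mxE expr2.
have pE0 : 0 <= (rsubmx v *m (rsubmx v)^T) 0 0.
  by rewrite pE; apply: sumr_ge0 => j _; exact: sqr_ge0.
have [lv0|/gpos lv0] := eqVneq (lsubmx v) 0; last by apply: ltr_wpDr.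
rewrite lv0 !mul0mx mxE add0r lt_def pE0 andbT; move: v0; rewrite lv0 eqxx /=.
apply: contraNneq => /eqP; rewrite pE psumr_eq0; last by move=> j _; exact: sqr_ge0.
move=> /allP z; apply/eqP/rowP => j; rewrite [RHS]mxE; apply/eqP.
by rewrite -sqrf_eq0; apply: z; rewrite mem_index_enum.
Qed.

Lemma invmx_prod_metric gM : posdef gM ->
  invmx (prod_metric gM) = prod_metric (invmx gM).
Proof.
move=> gp; have gu := posdef_unit (prod_metric_posdef gp).
by rewrite /prod_metric invmx_block_diag // invmx1.
Qed.

(** The full trace is [(1 + eps) l - 1]. The Euclidean part of a unit vector has norm at most 1, so
    the subtracted value is at most [1 + eps]; what remains is at least [(1 + eps) (l - 1) - 1],
    hence at least [eps] when [l >= 2]. *)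
Lemma rho_trace_ge eps gM (nu : 'rV[R]_(n + (l + 1))) : (2 <= l)%N -> 0 <= eps ->
  posdef gM -> quadf (prod_metric gM) nu = 1 ->
  eps <= \tr (diag_mx (rho_coef eps) *m invmx (prod_metric gM))
         - quadf (diag_mx (rho_coef eps)) nu.
Proof.
move=> l2 e0 gp nu1.
have -> : \tr (diag_mx (rho_coef eps) *m invmx (prod_metric gM)) =
    (1 + eps) * l%:R - 1.
  rewrite (invmx_prod_metric gp) /mxtrace.
  under eq_bigr do rewrite mul_diag_mx.
  rewrite big_split_ord /= big1 ?add0r => [|a _]; last by rewrite mxE rho_coefl mul0r.
  rewrite big_split_ord /= big_ord1 [in X in _ + X]mxE rho_coef_s.
  rewrite block_mxEdr mxE eqxx mulr1n mulr1; congr (_ - _).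
  under eq_bigr do rewrite mxE rho_coef_t block_mxEdr mxE eqxx mulr1.
  by rewrite sumr_const card_ord mulr_natr.
have : \sum_(c < l + 1) nu 0 (rshift n c) ^+ 2 <= 1.
  move: nu1; rewrite -[nu in quadf _ nu]hsubmxK /quadf /prod_metric mul_row_block.
  rewrite tr_row_mx mul_row_col !mulmx0 addr0 add0r mulmx1 mxE => <-.
  rewrite ler_wpDl //; first exact: (posdef_ge0 _ gp).
  by rewrite mxE; apply: ler_sum => j _; rewrite !mxE expr2.
move=> sle; rewrite quadf_rho_coef big_split_ord /= [X in _ - (X + _)]big1 => [|a _]; last first.
  by rewrite rho_coefl mul0r.
move: sle; rewrite !big_split_ord /= !big_ord1 rho_coef_s add0r.
under [X in _ - (X + _)]eq_bigr do rewrite rho_coef_t.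
rewrite -mulr_sumr; set T := \sum_(i < l) _; set s := nu 0 _.
have T0 : 0 <= T by apply: sumr_ge0 => j _; exact: sqr_ge0.
have s0 := sqr_ge0 s; have : 2 <= l%:R :> R by rewrite ler_nat.
by move: (l%:R) => L L2 Ts; nra.
Qed.

End TraceInequality.

(** * The product M x R^l x R *)

Section ProductAtlas.
Variables (R : realType) (M : topologicalType) (n l : nat).
Variables (A : riem_atlas R M n) (hA : riemannian_manifold A).
Variable i : chart A.

Let P := prod_atlas A (eucl_atlas R l).
Let ii : chart P := (i, tt).
Implicit Types y : 'rV[R]_(n + (l + 1)).

Lemma cimage_prod y : cimage ii y <-> cimage i (lsubmx y).
Proof.
split=> [[[p [t s]] [/= ip _] <-]|[p ip py]]; first by rewrite row_mxKl; exists p.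
exists (p, (lsubmx (rsubmx y), rsubmx (rsubmx y) 0 0)) => //=.
rewrite py -[RHS]hsubmxK; congr row_mx; rewrite -[RHS]hsubmxK; congr row_mx.
by apply/matrixP => a b; rewrite !ord1 mxE.
Qed.

Lemma metric_posdef x : cimage i x -> posdef (metric i x).
Proof. by move=> ix; have [_ _ _ /(_ i) [_ /(_ _ ix)]] := hA. Qed.

Lemma prod_metricE y : metric ii y = prod_metric l (metric i (lsubmx y)).
Proof. by []. Qed.

(** Properness makes the limit in [dwithin] unique, also over the boundary of [M]: coordinate
    vectors have nonnegative entries, so small positive increments never leave the half-space. *)
Lemma within_line_proper y e : cimage ii y ->
  ProperFilter (within [set h : R | cimage ii (h *: delta_mx 0 e + y)] (0 : R)^').
Proof.
move=> /cimage_prod iy.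
have lin h : lsubmx (h *: delta_mx 0 e + y) = h *: lsubmx (delta_mx 0 e) + lsubmx y.
  by rewrite linearD linearZ.
have w0 (j : 'I_n) : 0 <= lsubmx (delta_mx 0 e : 'rV[R]_(n + (l + 1))) 0 j.
  by rewrite !mxE ler0n.
move: (lsubmx _) lin w0 => w lin w0.
have [_ _ /(_ i) [_ [b [W oW iW]] _ _ _] _ _] := hA.
have near_right : \forall h \near (0 : R)^'+, cimage ii (h *: delta_mx 0 e + y).
  have [Oy my] : W (lsubmx y) /\ model b (lsubmx y) by move: iy; rewrite iW.
  have : \forall h \near (0 : R)^'+, W (h *: w + lsubmx y).
    apply: (@cvg_within _ (nbhs (0 : R))); apply: line_near; exact: open_nbhs_nbhs.
  apply: filterS2 (nbhs_right_ge (0 : R)) => h h0 Oh.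
  apply/cimage_prod; rewrite iW lin; split=> //= bb j j0.
  by rewrite mxE [X in X + _]mxE addr_ge0 ?mulr_ge0 //; exact: my.
apply: Build_ProperFilter_ex => Q; move=> wQ.
have : \forall h \near (0 : R)^'+, Q h.
  have : \forall h \near (0 : R)^'+, cimage ii (h *: delta_mx 0 e + y) -> Q h.
    have {}wQ : \forall h \near (0 : R), h != 0 ->
        cimage ii (h *: delta_mx 0 e + y) -> Q h.
      exact: wQ.
    by rewrite near_withinE; apply: filterS wQ => h Qh h0; apply: Qh; rewrite gt_eqF.
  by move=> nQ; apply: filterS2 near_right nQ => h ih; apply.
move=> nQ; have [h Qh] := @filter_ex _ _ (at_right_proper_filter (0 : R)) Q nQ.
by exists h.
Qed.

Lemma dwithin_line_const (F : 'rV[R]_(n + (l + 1)) -> R) e y : cimage ii y ->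
  (forall h : R, F (h *: delta_mx 0 e + y) = F y) ->
  dwithin (cimage ii) F (delta_mx 0 e) y = 0.
Proof.
move=> iy Fc; have PF := within_line_proper e iy.
apply: cvg_lim => //; rewrite /dquot_within.
rewrite (_ : (fun h : R => _) = cst 0); first exact: cvg_cst.
by apply/funext => h; rewrite Fc subrr mulr0.
Qed.

Lemma lsubmx_delta_r (h : R) (j : 'I_(l + 1)) y :
  lsubmx (h *: delta_mx 0 (rshift n j) + y) = lsubmx y.
Proof.
apply/rowP => a; rewrite !mxE eqxx /= [_ == _](_ : _ = false) ?mulr0 ?add0r //.
by apply/negbTE; rewrite eq_lrshift.
Qed.

(** With one lower index Euclidean, each of the three metric derivatives vanishes: either it is
    taken in a Euclidean direction, on which the metric does not depend, or it concerns a
    coefficient with a Euclidean index, which is constant. *)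
Lemma christoffel_flat y c e j : cimage ii y ->
  christoffel ii y c e (rshift n j) = 0.
Proof.
move=> iy; rewrite /christoffel big1 ?mulr0 // => a _.
have flat d b : (forall y1 y2 : 'rV[R]_(n + (l + 1)),
     metric ii y1 d b = metric ii y2 d b) -> forall f, dmetric ii y f d b = 0.
  by move=> E f; apply: dwithin_line_const.
rewrite [dmetric _ _ (rshift n j) _ _]dwithin_line_const //; last first.
  by move=> h; rewrite !prod_metricE lsubmx_delta_r.
rewrite [dmetric _ _ e _ _]flat; last first.
  move=> y1 y2; rewrite !prod_metricE /prod_metric -[a]splitK.
  by case: (fintype.split a) => b /=; rewrite ?block_mxEdl ?block_mxEdr // !mxE.
rewrite [dmetric _ _ a _ _]flat ?addr0 ?subr0 ?mulr0 //.
move=> y1 y2; rewrite !prod_metricE /prod_metric -[e]splitK.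
by case: (fintype.split e) => b /=; rewrite ?block_mxEur ?block_mxEdr // !mxE.
Qed.

(** The inverse metric in the gradient cancels the metric in the inner product, leaving the
    differential of [psi] applied to [nu]. *)
Lemma inner_gradient psi y nu : cimage ii y ->
  inner ii y (gradient psi ii y) nu =
  \sum_c dwithin (cimage ii) (psi \o param ii) (delta_mx 0 c) y * nu 0 c.
Proof.
move=> /cimage_prod iy; rewrite /inner /gradient prod_metricE mulmxKV; last first.
  exact/posdef_unit/prod_metric_posdef/metric_posdef.
by rewrite mxE; apply: eq_bigr => c _; rewrite !mxE.
Qed.

End ProductAtlas.

(** * Radial weights *)

Section RadialWeight.
Variable R : realType.

Lemma enorm_sqr l (t : 'rV[R]_l) : enorm t ^+ 2 = \sum_j t 0 j ^+ 2.
Proof. by rewrite sqr_sqrtr //; apply: sumr_ge0 => j _; exact: sqr_ge0. Qed.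

Lemma enorm_line l (t : 'rV[R]_l) j (r : R) :
  enorm (r *: delta_mx 0 j + t) = Num.sqrt (enorm t ^+ 2 + (2 * t 0 j) * r + r ^+ 2).
Proof.
rewrite {1}/enorm enorm_sqr (bigD1 j) //= (bigD1 j (F := fun j => t 0 j ^+ 2)) //=.
rewrite !mxE !eqxx mulr1; congr Num.sqrt.
rewrite (eq_bigr (fun a => t 0 a ^+ 2)); last first.
  by move=> a aj; rewrite !mxE (negbTE aj) andbF mulr0 add0r.
ring.
Qed.

Lemma is_derive_nondecreasing_ge0 (delta : R -> R) (x d : R) : 0 < x ->
  {in `[0, +oo[ &, {homo delta : x y / x <= y}} ->
  is_derive x 1 delta d -> 0 <= d.
Proof.
move=> x0 mono [dc <-]; apply: limr_ge => //.
have : \forall h \near (0 : R), `|h| < x by apply: nbhs0_lt.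
rewrite near_withinE; apply: filterS => h hx h0 /=.
rewrite [h *: 1]mulr1 /GRing.scale /=.
have xitv : x \in `[0, +oo[ by rewrite in_itv /= (ltW x0).
have hitv : h + x \in `[0, +oo[.
  by rewrite in_itv /= andbT -lerBlDr sub0r ltW //; move: hx; rewrite ltr_norml => /andP[].
have [h_gt0|h_le0] := ltP 0 h.
  by rewrite mulr_ge0 ?invr_ge0 ?(ltW h_gt0) // subr_ge0 mono // lerDr ltW.
by rewrite mulr_le0 ?invr_le0 // subr_le0 mono // gerDr.
Qed.

(** The derivative is [delta'(|t|) t_j / |t|], and its product with [t_j] has the sign of [delta'].
    The condition on [t_j] keeps [|t|] away from 0, where the square root is not differentiable. *)
Lemma radial_derive (delta : R -> R) l (t : 'rV[R]_l) j :
  {in `[0, +oo[ &, {homo delta : x y / x <= y}} ->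
  @Ck R R^o 1 [set` `[0, +oo[] delta -> t 0 j != 0 ->
  exists2 d, is_derive t (delta_mx 0 j) (fun t => delta (enorm t)) d & 0 <= d * t 0 j.
Proof.
move=> mono dC tj0.
have tsq : 0 < enorm t ^+ 2.
  rewrite enorm_sqr (bigD1 j) //= ltr_pwDl // ?exprn_even_gt0 //.
  by apply: sumr_ge0 => a _; exact: sqr_ge0.
have et0 : 0 < enorm t.
  by rewrite lt_def sqrtr_ge0 andbT; apply: contraTneq tsq => ->; rewrite expr0n ltxx.
pose N (r : R) := enorm t ^+ 2 + (2 * t 0 j) * r + r ^+ 2.
have N0 : N 0 = enorm t ^+ 2 by rewrite /N mulr0 expr0n /= !addr0.
have Nd : is_derive (0 : R) 1 N (2 * t 0 j).
  rewrite (_ : N = (cst (enorm t ^+ 2) + (2 * t 0 j) \*: id) + id ^+ 2).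
    have Xd := is_derive_id (0 : R) (1 : R).
    have := is_deriveD (is_deriveD (is_derive_cst (enorm t ^+ 2 : R^o) (0 : R) (1 : R))
      (is_deriveZ (2 * t 0 j) Xd)) (is_deriveX 2 Xd).
    by rewrite add0r expr1 mulr0 scale0r addr0 [_ *: 1]mulr1.
  by apply/funext => r.
have sd : is_derive (N 0) 1 Num.sqrt (2 * enorm t)^-1.
  rewrite -[enorm t in X in is_derive _ _ _ X]ger0_norm ?ltW // -sqrtr_sqr -N0.
  by apply: is_derive1_sqrt; rewrite N0.
have dd : is_derive (enorm t) 1 delta (@dwithin R R^o [set` `[0, +oo[] delta 1 (enorm t)).
  apply: (Ck_is_derive _ dC).
  by rewrite interior_itv_bndy /= in_itv /= andbT.
have d0 := is_derive_nondecreasing_ge0 et0 mono dd.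
move: (dwithin _ _ _ _) dd d0 => d dd d0.
have sN0 : Num.sqrt (N 0) = enorm t by rewrite N0 sqrtr_sqr ger0_norm ?ltW.
have := is_derive1_comp sd Nd; rewrite -sN0 in dd => sNd.
have := @is_derive1_comp _ delta (Num.sqrt \o N) 0 _ _ dd sNd.
set D := (X in is_derive _ _ _ X) => HD; exists D.
  suff : is_derive (0 *: delta_mx 0 j + t) (delta_mx 0 j) (fun t => delta (enorm t)) D.
    by rewrite scale0r add0r.
  apply: (is_derive_line _ _ _ _ _).2.
  rewrite (_ : (fun r : R => _) = delta \o (Num.sqrt \o N)) //.
  by apply/funext => r; rewrite enorm_line.
have -> : D * t 0 j = d * ((2 * enorm t)^-1 * (2 * t 0 j ^+ 2)) by rewrite /D; ring.
by rewrite mulr_ge0 // mulr_ge0 ?invr_ge0 // mulr_ge0 ?sqr_ge0 // ltW.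
Qed.

End RadialWeight.

(** * The derivative of the weight along the gradient of the perturbed function *)

Section Drift.
Variables (R : realType) (M : topologicalType) (n l : nat).
Variables (A : riem_atlas R M n) (hA : riemannian_manifold A).
Variables (h : M -> R) (delta : R -> R) (psi : M * ('rV[R]_l * R) -> R).
Hypothesis delta_mono : {in `[0, +oo[ &, {homo delta : x y / x <= y}}.
Hypothesis delta_C1 : @Ck R R^o 1 [set` `[0, +oo[] delta.
Hypothesis psiE : forall p t s,
  expR (psi (p, (t, s))) = expR (h p) * expR (delta (enorm t)).

(** The vector with entries [rho_coef] times [y] is half the gradient of [(1 + eps)|t|^2 - s^2]. It
    has no component along [M], and [psi] is constant in [s], so only the radial derivatives in [t]
    contribute. *)
Lemma radial_drift_ge0 (i : chart A) (y : 'rV[R]_(n + (l + 1))) eps :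
  @cimage R _ _ (prod_atlas A (eucl_atlas R l)) (i, tt) y -> 0 <= eps ->
  0 <= \sum_c dwithin (@cimage R _ _ (prod_atlas A (eucl_atlas R l)) (i, tt))
         (psi \o @param R _ _ (prod_atlas A (eucl_atlas R l)) (i, tt))
         (delta_mx 0 c) y * (rho_coef n l eps 0 c * y 0 c).
Proof.
set P := prod_atlas _ _; set ii := (i, tt) : chart P => iy eps0.
have psiE' p t s : psi (p, (t, s)) = h p + delta (enorm t).
  by apply: expR_inj; rewrite psiE expRD.
have psipE z : (psi \o @param R _ _ P ii) z =
    h (param i (lsubmx z)) + delta (enorm (lsubmx (rsubmx z))) by rewrite /= psiE'.
rewrite big_split_ord /= big1 ?add0r => [|a _]; last first.
  by rewrite rho_coefl mul0r mulr0.
rewrite big_split_ord /= big_ord1 [X in _ + X](_ : _ = 0) ?addr0; last first.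
  rewrite (dwithin_line_const hA) ?mul0r // => r.
  rewrite !psipE lsubmx_delta_r; congr (_ + delta (enorm _)).
  by apply/rowP => a; rewrite !mxE eqxx /= eq_rshift eq_lrshift mulr0 add0r.
apply: sumr_ge0 => j _; rewrite rho_coef_t.
pose t := lsubmx (rsubmx y).
have -> : y 0 (rshift n (lshift 1 j)) = t 0 j by rewrite !mxE.
(* If [t_j = 0] the factor [t_j] annihilates the term, whatever the value of [dwithin]. *)
have [->|tj0] := eqVneq (t 0 j) 0; first by rewrite !mulr0.
have [d dd d0] := radial_derive delta_mono delta_C1 tj0.
suff -> : dwithin (cimage ii) (psi \o param ii) (delta_mx 0 (rshift n (lshift 1 j))) y = d.
  by rewrite mulrCA mulr_ge0 // addr_ge0.
(* A Euclidean direction leaves the [M] coordinates fixed, so the line stays in the chart image even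
   over the boundary of [M]. *)
apply: is_derive_dwithin.
  apply: filterE => r; apply/cimage_prod; rewrite lsubmx_delta_r.
  exact: (cimage_prod _ _).1 iy.
rewrite -[y in is_derive y]add0r -(scale0r (delta_mx 0 (rshift n (lshift 1 j)))).
apply: (is_derive_line _ _ _ _ _).2.
have {dd} : is_derive (0 : R) 1 (fun r : R => delta (enorm (r *: delta_mx 0 j + t))) d.
  by apply: (is_derive_line (fun t => delta (enorm t)) _ _ _ _).1; rewrite scale0r add0r.
move=> dd; rewrite (_ : (fun r : R => _) = cst (h (param i (lsubmx y))) +
    (fun r : R => delta (enorm (r *: delta_mx 0 j + t)))).
  by rewrite -[d]add0r; apply: is_deriveD.
apply/funext => r; rewrite psipE lsubmx_delta_r; congr (_ + delta (enorm _)).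
apply/rowP => a; rewrite !mxE eqxx /=; congr (_ * _%:R + _).
by rewrite eq_rshift eq_lshift.
Qed.

End Drift.

(** * Interior points of a hypersurface *)

Section InteriorPoint.
Variables (R : realType) (M : topologicalType) (n l : nat).
Variables (A : riem_atlas R M n) (hA : riemannian_manifold A).
Variables (h : M -> R) (delta : R -> R) (psi : M * ('rV[R]_l * R) -> R).
Hypothesis delta_mono : {in `[0, +oo[ &, {homo delta : x y / x <= y}}.
Hypothesis delta_C1 : @Ck R R^o 1 [set` `[0, +oo[] delta.
Hypothesis psiE : forall p t s,
  expR (psi (p, (t, s))) = expR (h p) * expR (delta (enorm t)).

Let P := prod_atlas A (eucl_atlas R l).
Let m := (n + (l + 1))%N.

Variables (Sig : set (M * ('rV[R]_l * R))).
Variable nu : chart P -> M * ('rV[R]_l * R) -> 'rV[R]_(n + (l + 1)).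
Hypotheses (hnu : @unit_normal R _ m P Sig nu) (hmin : @psi_minimal R _ m P psi Sig nu).

Variables (b : bool) (D : set 'rV[R]_m.-1) (X : 'rV[R]_m.-1 -> M * ('rV[R]_l * R)).
Hypothesis patchX : @is_patch R _ m P Sig b D X.
Variables (u : 'rV[R]_m.-1) (i : chart A).
Hypotheses (Du : D° u) (iu : cdom i (X u).1).

Let ii : chart P := (i, tt).
Let E : set 'rV[R]_m.-1 := @pdom R _ m P ii D X.
Let Y (x : 'rV[R]_m.-1) : 'rV[R]_(n + (l + 1)) := Defs.coord ii (X x).
Let J (x : 'rV[R]_m.-1) : 'M[R]_(m.-1, n + (l + 1)) := @tangent R _ m P ii D X x.
Let g (x : 'rV[R]_m.-1) : 'M[R]_(n + (l + 1)) := metric ii (Y x).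

(* Y2 a e c is d_a d_e Y_c at u, and dnu a c is d_a nu_c. *)
Let Y2 (a e : 'I_m.-1) (c : 'I_(n + (l + 1))) : R :=
  dwithin E (dwithin E (fun x => Y x 0 c) (delta_mx 0 e)) (delta_mx 0 a) u.
Let dnu (a : 'I_m.-1) (c : 'I_(n + (l + 1))) : R :=
  dwithin E (fun x => nu ii (X x) 0 c) (delta_mx 0 a) u.

(** * Calculus in a patch near an interior point *)

Lemma patch_continuous : {for u, continuous X}.
Proof.
have [_ _ cX _ _] := patchX.
move: cX => /subspace_continuousP/(_ u (interior_subset Du)).
by rewrite within_interior.
Qed.

Lemma pdom_interior : E° u.
Proof.
have [_ _ /(_ i) [oi _ _ _ _] _ _] := hA.
apply: filterI; first exact: Du.
apply: patch_continuous; exists (cdom i, setT) => //=.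
by split; [exact: open_nbhs_nbhs|exact: filterT].
Qed.

Lemma pdom_near : \forall x \near u, E° x.
Proof. exact: nbhs_interior pdom_interior. Qed.

Let smoothY c : smooth E (fun x => Y x 0 c).
Proof. by have [_ _ _ _ /(_ ii) [/(_ c)]] := patchX. Qed.

Lemma tangentE x a c : J x a c = dwithin E (fun x => Y x 0 c) (delta_mx 0 a) x.
Proof. by rewrite mxE. Qed.

Lemma is_derive_coord x v c : E° x ->
  is_derive x v (fun x => Y x 0 c) (\sum_a v 0 a * J x a c).
Proof.
move=> Ex.
have Ex' : \forall y \near x, E° y by exact: nbhs_interior.
under eq_bigr do rewrite tangentE.
apply: (is_derive_row (D := fun a => dwithin E (fun x => Y x 0 c) (delta_mx 0 a))) => a.
  by apply: filterS Ex' => y; apply: Ck_is_derive; exact: (smoothY c 1).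
by have [_ /(_ (delta_mx 0 a)) [_ C0]] := smoothY c 1; exact: (Ck_continuous (k := 0) C0).
Qed.

Lemma is_derive_tangent v a c :
  is_derive u v (fun x => J x a c) (\sum_e v 0 e * Y2 e a c).
Proof.
rewrite (_ : (fun x => _) = dwithin E (fun x => Y x 0 c) (delta_mx 0 a)); last first.
  by apply/funext => x; rewrite tangentE.
have [_ /(_ (delta_mx 0 a)) [_ C1]] := smoothY c 2.
apply: (is_derive_row (D := fun e =>
  dwithin E (dwithin E (fun x => Y x 0 c) (delta_mx 0 a)) (delta_mx 0 e))) => e.
  by apply: filterS pdom_near => y; exact: (Ck_is_derive (k := 0) _ C1).
by have [_ /(_ (delta_mx 0 e)) [_ C0]] := C1; exact: (Ck_continuous (k := 0) C0 pdom_interior).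
Qed.

Lemma tangent_continuous a c : {for u, continuous (fun x => J x a c)}.
Proof.
rewrite (_ : (fun x => _) = dwithin E (fun x => Y x 0 c) (delta_mx 0 a)); last first.
  by apply/funext => x; rewrite tangentE.
have [_ /(_ (delta_mx 0 a)) [_ C0]] := smoothY c 1.
exact: (Ck_continuous (k := 0) C0 pdom_interior).
Qed.

Lemma is_derive_normal a c :
  is_derive u (delta_mx 0 a) (fun x => nu ii (X x) 0 c) (dnu a c).
Proof.
have [_ _ /(_ _ _ _ patchX ii) [/(_ c 1) C1 _]] := hnu.
exact: (Ck_is_derive (k := 0) _ C1 pdom_interior).
Qed.

Lemma pdom_cimage x : E x -> cimage ii (Y x).
Proof. by move=> [_ Xi]; exists (X x). Qed.

Lemma pdom_cimageM x : E x -> cimage i (lsubmx (Y x)).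
Proof. by move=> /pdom_cimage /cimage_prod. Qed.

Lemma metric_posdef_patch x : E x -> posdef (g x).
Proof. by move=> Ex; apply/prod_metric_posdef/metric_posdef/pdom_cimageM. Qed.

(** [X u] may lie over the boundary of [M], where the metric is continuous only within the chart
    image; near [u] the patch takes its values in that image. *)
Lemma metric_continuous a c : {for u, continuous (fun x => metric i (lsubmx (Y x)) a c)}.
Proof.
have [_ _ /(_ i) [oi _ _ cc _] /(_ i) [gs _] _] := hA.
have cY : (lsubmx (Y x)) @[x --> u] --> lsubmx (Y u).
  have lY x : lsubmx (Y x) = Defs.coord i (X x).1 by rewrite row_mxKl.
  rewrite (_ : (fun x => _) = Defs.coord i \o (fst \o X)); last by apply/funext => x; rewrite lY.
  rewrite lY; apply: cvg_comp.
    apply: cvg_comp; [exact: patch_continuous|exact: cvg_fst].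
  move: cc => /subspace_continuousP/(_ _ iu).
  by rewrite within_interior //; exact: open_nbhs_nbhs.
have /subspace_continuousP/(_ _ (pdom_cimageM (interior_subset pdom_interior))) := (gs a c 0%N).1.
move=> cg B /cg; rewrite /= /within /= => /cY.
apply: filterS2 pdom_near => x /interior_subset/pdom_cimageM Ex; exact.
Qed.

Lemma metric_sym x : E x -> (g x)^T = g x.
Proof. by move=> /metric_posdef_patch []. Qed.

Lemma tangent_normal x : E x -> J x *m g x *m (nu ii (X x))^T = 0.
Proof.
move=> Ex; have [_ _ /(_ _ _ _ patchX ii) [_ /(_ x Ex) Jn]] := hnu.
apply/matrixP => a c; rewrite ord1 [RHS]mxE -(Jn a) /inner -row_mul !mxE.
by apply: eq_bigr => d _; rewrite !mxE.
Qed.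

Lemma normal_unit x : E x -> quadf (g x) (nu ii (X x)) = 1.
Proof.
move=> [Dx Xi]; have [_ n1 _] := hnu; apply: n1 => //.
by have [_ [W oW XW] _ _ _] := patchX; have [] : (Sig `&` W) (X x) by rewrite -XW; exists x.
Qed.

(* Only the continuity of the metric is used here: the factors of nu that are
   multiplied by a non-constant metric coefficient vanish at u. *)
Lemma second_fundamental_form a e :
  (forall d : 'I_n, nu ii (X u) 0 (lshift _ d) = 0) ->
  \sum_d (J u *m g u) e d * dnu a d = - \sum_d Y2 a e d * nu ii (X u) 0 d.
Proof.
move=> nuM; have Eu := interior_subset pdom_interior.
(* The sum of the [T d] is the inner product of the [e]-th tangent vector with the normal. It
   vanishes on the patch, so its derivative along the [a]-th direction vanishes too. *)
pose T d x := (J x *m g x) e d * nu ii (X x) 0 d.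
have Td d : is_derive u (delta_mx 0 a) (T d)
    ((J u *m g u) e d * dnu a d + Y2 a e d * nu ii (X u) 0 d).
  rewrite /T -[d](@splitK n (l + 1)); case: (fintype.split d) => j /=.
    rewrite [nu ii (X u) 0 _]nuM mulr0 addr0.
    apply: is_deriveM_vanish; [|exact: is_derive_normal|exact: nuM].
    rewrite (_ : (fun x => _) = \sum_(c < n)
        ((fun x => J x e (lshift (l + 1) c)) * (fun x => metric i (lsubmx (Y x)) c j))).
      apply: (big_ind (fun f => {for u, continuous f})) => [|f1 f2 c1 c2|c _].
      - exact: cst_continuous.
      - exact: continuousD.
      - by apply: continuousM; [exact: tangent_continuous|exact: metric_continuous].
    apply/funext => x; rewrite fct_sumE -[J x]hsubmxK /g prod_metricE mul_row_block.
    rewrite !mulmx0 addr0 row_mxEl mxE.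
    by apply: eq_bigr => c _; rewrite [lsubmx _ _ _]mxE.
  have JgE x : (J x *m g x) e (rshift n j) = J x e (rshift n j).
    rewrite -[J x]hsubmxK /g prod_metricE mul_row_block !mulmx0 add0r mulmx1.
    by rewrite !row_mxEr.
  rewrite JgE (_ : (fun x => _) =
    (fun x => J x e (rshift n j)) * (fun x => nu ii (X x) 0 (rshift n j))); last first.
    by apply/funext => x; rewrite JgE.
  have Jd := is_derive_tangent (delta_mx 0 a) e (rshift n j).
  have nd := is_derive_normal a (rshift n j).
  apply: is_derive_eq.
  rewrite (bigD1 a) //= big1 ?addr0; last first.
    by move=> k /negbTE ka; rewrite mxE ka andbF mul0r.
  by rewrite [delta_mx _ _ _ _]mxE !eqxx mul1r /GRing.scale /= (mulrC (Y2 _ _ _)).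
have := is_derive_sum Td.
have zero : is_derive u (delta_mx 0 a) (\sum_d T d) 0.
  apply: (near_eq_is_derive (f := cst (0 : R))).
  apply: filterS pdom_near => x /interior_subset Ex.
  have /matrixP/(_ e 0) := tangent_normal Ex; rewrite [LHS]mxE [RHS]mxE => JN.
  rewrite fct_sumE -[LHS]/(0 : R) -[LHS]JN.
  by apply: eq_bigr => d _; rewrite [_^T _ _]mxE.
move=> [_]; have [_ ->] := zero => /esym/eqP.
by rewrite big_split /= addr_eq0 => /eqP.
Qed.

(** * First and second order conditions at an interior maximum *)

Variable eps : R.
Hypotheses (eps_gt0 : 0 < eps) (l_ge2 : (2 <= l)%N).

Let q := rho_coef n l eps.
Let f (x : M * ('rV[R]_l * R)) : R := (1 + eps) * enorm x.2.1 ^+ 2 - x.2.2 ^+ 2.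
(** [F] is half the differential of [f] in coordinates, and [T] pairs it with the second derivatives
    of the patch; [J diag(q) J^T + T] is then half the Hessian of [f \o X] at [u]. *)
Let F : 'rV[R]_(n + (l + 1)) := \row_c (q 0 c * Y u 0 c).
Let T : 'M[R]_m.-1 := \matrix_(a, e) \sum_c F 0 c * Y2 a e c.
Let Dv (v : 'rV[R]_m.-1) x c := \sum_a v 0 a * J x a c.

Lemma perturbed_rhoE x : f (X x) = \sum_c q 0 c * Y x 0 c ^+ 2.
Proof.
rewrite big_split_ord /= big1 ?add0r => [|a _]; last by rewrite rho_coefl mul0r.
rewrite big_split_ord /= big_ord1 rho_coef_s mulN1r /f enorm_sqr mulr_sumr.
congr (_ - _ ^+ 2); last by rewrite /Y /= !row_mxEr mxE.
by apply: eq_bigr => j _; rewrite rho_coef_t /Y /= row_mxEr row_mxEl.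
Qed.

Lemma is_derive_perturbed_rho x v : E° x ->
  is_derive x v (f \o X) (\sum_c q 0 c * (2 * Y x 0 c * Dv v x c)).
Proof.
move=> Ex; rewrite (_ : f \o X = \sum_c (q 0 c \*: (fun x => Y x 0 c) ^+ 2)).
  apply: is_derive_sum => c; apply: is_deriveZ.
  have Yd := is_derive_coord v c Ex.
  by apply: is_derive_eq; rewrite expr1.
by apply/funext => z /=; rewrite perturbed_rhoE fct_sumE.
Qed.

Lemma is_derive2_perturbed_rho v :
  is_derive u v (fun x => \sum_c q 0 c * (2 * Y x 0 c * Dv v x c))
    (2 * \sum_c q 0 c * (Dv v u c ^+ 2 +
           Y u 0 c * \sum_a v 0 a * \sum_e v 0 e * Y2 e a c)).
Proof.
have Dd c : is_derive u v (fun x => Dv v x c) (\sum_a v 0 a * \sum_e v 0 e * Y2 e a c).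
  rewrite (_ : (fun x => _) = \sum_a (v 0 a \*: (fun x => J x a c))).
    by apply: is_derive_sum => a; apply: is_deriveZ; exact: is_derive_tangent.
  by apply/funext => x; rewrite fct_sumE.
rewrite (_ : (fun x => _) =
    \sum_c ((2 * q 0 c) \*: ((fun x => Y x 0 c) * (fun x => Dv v x c)))); last first.
  apply/funext => x; rewrite fct_sumE; apply: eq_bigr => c _.
  by rewrite -[RHS]/((2 * q 0 c) * (Y x 0 c * Dv v x c)); ring.
rewrite mulr_sumr; apply: is_derive_sum => c.
have Yd := is_derive_coord v c pdom_interior.
by apply: is_derive_eq; rewrite /GRing.scale /= -/(Dv v u c); ring.
Qed.

Hypothesis umax : \forall x \near u, f (X x) <= f (X u).

Lemma interior_max_hessian v :
  \sum_c F 0 c * Dv v u c = 0 /\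
  quadf (J u *m diag_mx q *m (J u)^T + T) v <= 0.
Proof.
pose G x := \sum_c q 0 c * (2 * Y x 0 c * Dv v x c).
have phid : \forall s \near (0 : R),
    is_derive (s : R) 1 (fun r : R => f (X (r *: v + u))) (G (s *: v + u)).
  apply: filterS (line_near v pdom_near) => s Es.
  by apply: (is_derive_line (f \o X) v u s _).1; exact: is_derive_perturbed_rho.
have dphid := is_derive2_perturbed_rho v.
rewrite -[u in is_derive u]add0r -{1}(scale0r v) in dphid.
move/(is_derive_line G v u 0 _).1: dphid => dphid.
have [] := second_derivative_test phid dphid.
  by have := line_near v umax; apply: filterS => s; rewrite scale0r add0r.
rewrite scale0r add0r /G => G0 H0; split.
  have /eqP : 2 * \sum_c F 0 c * Dv v u c = 0.
    by rewrite -[RHS]G0 mulr_sumr; apply: eq_bigr => c _; rewrite mxE; ring.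
  by rewrite mulf_eq0 pnatr_eq0 /= => /eqP.
move: H0; rewrite pmulr_rle0 //; apply: le_trans.
rewrite /quadf mulmxDr mulmxDl mxE.
have -> : (v *m (J u *m diag_mx q *m (J u)^T) *m v^T) 0 0 = \sum_c q 0 c * Dv v u c ^+ 2.
  transitivity (quadf (diag_mx q) (v *m J u)); first by rewrite /quadf trmx_mul !mulmxA.
  by rewrite quadf_rho_coef; apply: eq_bigr => c _; rewrite [(_ *m _) _ _]mxE.
have -> : (v *m T *m v^T) 0 0 =
    \sum_c q 0 c * (Y u 0 c * \sum_a v 0 a * \sum_e v 0 e * Y2 e a c).
  rewrite mxE; under eq_bigr => a _.
    rewrite !mxE mulr_suml.
    under eq_bigr => e _ do rewrite mxE mulr_sumr mulr_suml.
    rewrite exchange_big; over.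
  rewrite exchange_big; apply: eq_bigr => c _.
  rewrite mulrA mulr_sumr; apply: eq_bigr => a _.
  rewrite !mulr_sumr; apply: eq_bigr => e _.
  by rewrite [F 0 c]mxE; ring.
by rewrite -big_split /=; apply: ler_sum => c _; rewrite mulrDr.
Qed.

(** The first order condition makes [F] orthogonal to every tangent vector. The multiple may be
    0. *)
Lemma interior_max_normal : exists lam, F = lam *: nu ii (X u).
Proof.
have Eu := interior_subset pdom_interior.
have [_ _ _ _ /(_ ii) [_ /(_ u Eu) Jf]] := patchX.
have em : (n + (l + 1))%N = (m.-1 + 1)%N by rewrite /m !addn1 addnS.
apply: (normal_unique em (metric_posdef_patch Eu) Jf (tangent_normal Eu) (normal_unit Eu)).
(* [F] lives in the Euclidean block, where the metric is the identity, so the differential and the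
   gradient have the same coordinates. *)
have FE : F = row_mx 0 (rsubmx F).
  rewrite -[LHS]hsubmxK; congr row_mx; apply/rowP => a.
  by rewrite [lsubmx _ _ _]mxE [F _ _]mxE rho_coefl mul0r mxE.
have -> : J u *m g u *m F^T = J u *m F^T.
  rewrite -mulmxA; congr (_ *m _); rewrite {1}FE tr_row_mx trmx0 /g prod_metricE.
  rewrite /prod_metric mul_block_col !mulmx0 mul0mx !add0r mul1mx.
  by rewrite [in RHS]FE tr_row_mx trmx0.
apply/matrixP => a c; rewrite ord1 [RHS]mxE mxE.
have [+ _] := interior_max_hessian (delta_mx 0 a).
move=> H; rewrite -[RHS]H; apply: eq_bigr => d _; rewrite [F^T _ _]mxE mulrC; congr (_ * _).
rewrite /Dv (bigD1 a) //= big1 ?addr0; first by rewrite [delta_mx _ _ _ _]mxE !eqxx mul1r.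
by move=> k /negbTE ka; rewrite [delta_mx _ _ _ _]mxE ka andbF mul0r.
Qed.

(** The trace of the Hessian against the inverse Gram matrix [K] is nonpositive. Yet its [diag_mx q]
    part is at least [eps], and its [T] part is [- lam] times the divergence of the normal, which by
    minimality is the derivative of [psi] along [F], hence nonnegative. *)
Lemma interior_max_absurd : False.
Proof.
have Eu := interior_subset pdom_interior.
have gp := metric_posdef_patch Eu.
have [_ _ _ _ /(_ ii) [_ /(_ u Eu) Jf]] := patchX.
have em : (n + (l + 1))%N = (m.-1 + 1)%N by rewrite /m !addn1 addnS.
have [lam FE] := interior_max_normal.
have Fc c : F 0 c = lam * nu ii (X u) 0 c by rewrite FE; apply: mxE.
have Fq c : F 0 c = q 0 c * Y u 0 c by apply: mxE.
pose K := invmx (J u *m g u *m (J u)^T).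
have Kp : posdef K by apply/posdef_inv/posdef_congr.
have : \tr (K *m (J u *m diag_mx q *m (J u)^T + T)) <= 0.
  by apply: posdef_trace_le0 => // v; have [] := interior_max_hessian v.
apply/negP; rewrite -ltNge mulmxDr mxtraceD ltr_pwDl //.
  rewrite (tangent_trace _ em gp Jf (tangent_normal Eu) (normal_unit Eu)).
  apply: (lt_le_trans eps_gt0).
  apply: rho_trace_ge (ltW eps_gt0) _ (normal_unit Eu) => //.
  exact/metric_posdef/pdom_cimageM.
pose B := @cov_normal R _ m P nu ii D X u *m g u *m (J u)^T.
have BT : lam *: B = - T.
  (* If [lam = 0] then [F], and with it [T], vanishes. Otherwise the zero [M] block of [F = lam nu]
     forces that of [nu] to vanish. *)
  have [lam0|lam0] := eqVneq lam 0.
    suff -> : T = 0 by rewrite lam0 scale0r oppr0.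
    apply/matrixP => a e; rewrite [LHS]mxE [RHS]mxE big1 // => c _.
    by rewrite Fc lam0 !mul0r.
  have nuM d : nu ii (X u) 0 (lshift _ d) = 0.
    apply: (mulfI lam0); rewrite mulr0.
    by rewrite -Fc Fq rho_coefl mul0r.
  apply/matrixP => a e; rewrite [LHS]mxE.
  have -> : B a e = \sum_d (J u *m g u) e d * dnu a d.
    rewrite /B -mulmxA mxE; apply: eq_bigr => d _; rewrite mulrC; congr (_ * _).
      by rewrite -{1}(metric_sym Eu) -trmx_mul mxE.
    (* Every Christoffel term drops out: an [M] index [d'] meets a zero component of [nu], a
       Euclidean one a zero symbol. *)
    rewrite mxE [X in _ + X]big1 ?addr0 ?mxE // => c _.
    rewrite big1 // => d' _; rewrite -[d'](@splitK n (l + 1)).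
    case: (fintype.split d') => j /=; first by rewrite nuM mulr0.
    rewrite (christoffel_flat hA); first by rewrite !mul0r.
    exact: pdom_cimage.
  rewrite (second_fundamental_form a e nuM) [RHS]mxE [T _ _]mxE mulrN mulr_sumr.
  congr (- _); apply: eq_bigr => d _.
  by rewrite Fc mulrCA mulrC.
have -> : \tr (K *m T) = - (lam * \tr (K *m B)).
  rewrite -[T]opprK -BT.
  by rewrite mulmxN -scalemxAr linearN /= linearZ.
have := hmin patchX Eu; rewrite /psi_mean_curvature.
rewrite (inner_gradient hA _ _ (pdom_cimage Eu)) => /eqP.
rewrite subr_eq0 => /eqP divE.
rewrite -mulrN [- \tr _](_ : _ = - div_normal nu ii D X u) // divE mulr_sumr.
have := radial_drift_ge0 hA delta_mono delta_C1 psiE (pdom_cimage Eu) (ltW eps_gt0).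
congr (0 <= _); apply: eq_bigr => c _.
by rewrite -[q 0 c * _]/(q 0 c * Y u 0 c) -Fq Fc mulrCA.
Qed.

End InteriorPoint.

(** * The maximum principle *)

(** Off the face, the coordinate of index 0 is strictly positive, hence stays so nearby, and the
    half-space constraint is locally void. *)
Lemma model_open_interior (R : realType) (d : nat) (b : bool) (D : set 'rV[R]_d) u :
  model_open b D -> D u -> (b -> ~ model_bd u) -> D° u.
Proof.
move=> [W oW DW]; rewrite DW => -[Wu mu] nbd.
apply: filterI; first exact: open_nbhs_nbhs.
case: b mu nbd {DW} => [/(_ isT) mu /(_ isT) nbd|_ _]; last exact: filterE.
have : \forall x \near u, forall j : 'I_d, val j = 0%N -> 0 < (x : 'rV[R]_d) 0 j.
  apply: (@filter_forall _ _
    (fun (j : 'I_d) (x : 'rV[R]_d) => val j = 0%N -> 0 < x 0 j) (nbhs u)) => j.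
  have [j0|/eqP jn0] := eqVneq (val j) 0%N; last exact: filterE.
  have uj : 0 < u 0 j.
    rewrite lt_def mu // andbT; apply/eqP => uj0; apply: nbd; exists j => //.
  have := @coord_continuous _ _ _ 0 j u => /cvgr_gt/(_ _ uj).
  by apply: filterS => x xj _.
by apply: filterS => x xp _ j j0; apply/ltW/xp.
Qed.

Lemma enorm_sqr_continuous (R : realType) (M : topologicalType) (l : nat) :
  continuous (fun x : M * ('rV[R]_l * R) => enorm x.2.1 ^+ 2).
Proof.
rewrite (_ : (fun x => _) =
  \sum_j ((fun x : M * ('rV[R]_l * R) => x.2.1 0 j) * (fun x => x.2.1 0 j))).
  apply: (big_ind (fun f => continuous f)) => [|f1 f2 c1 c2 x|j _ x].
  - exact: cst_continuous.
  - by apply: continuousD; [exact: c1|exact: c2].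
  have cj : {for x, continuous (fun x : M * ('rV[R]_l * R) => x.2.1 0 j)}.
    apply: (@continuous_comp _ _ _ (fun x : M * ('rV[R]_l * R) => x.2.1) (fun t => t 0 j)).
      by apply: cvg_comp; [exact: cvg_snd|exact: cvg_fst].
    exact: coord_continuous.
  exact: continuousM.
by apply/funext => x; rewrite fct_sumE enorm_sqr; apply: eq_bigr => j _; rewrite expr2.
Qed.

Lemma perturbed_rho_continuous (R : realType) (M : topologicalType) (l : nat) (eps : R) :
  continuous (fun x : M * ('rV[R]_l * R) => (1 + eps) * enorm x.2.1 ^+ 2 - x.2.2 ^+ 2).
Proof.
move=> x; apply: (@continuousB _ R^o _
    (fun x : M * ('rV[R]_l * R) => (1 + eps) * enorm x.2.1 ^+ 2)).
  apply: (@continuousM _ _ (fun=> 1 + eps)); first exact: cst_continuous.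
  exact: enorm_sqr_continuous.
have c2 : {for x, continuous (fun x : M * ('rV[R]_l * R) => x.2.2)}.
  by apply: cvg_comp; exact: cvg_snd.
rewrite (_ : (fun x => _) = (fun x : M * ('rV[R]_l * R) => x.2.2) * (fun x => x.2.2)).
  exact: continuousM.
by apply/funext => y; rewrite expr2.
Qed.

Theorem mainTheorem11 (R : realType) (M : topologicalType) (n k : nat)
  (hk : (3 <= k)%N)
  (A : riem_atlas R M n) (hA : riemannian_manifold A)
  (hconn : connected [set: M])
  (sgn : chart A -> bool) (hor : orientation sgn)
  (h : M -> R) (hh : Ck_fun A 1 h)
  (delta : R -> R)
  (hdelta : {in `[0, +oo[ &, {homo delta : x y / x <= y}})
  (hdeltaC1 : @Ck R R^o 1 [set` `[0, +oo[] delta)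
  (hdelta0 : @dwithin R R^o [set` `[0, +oo[] delta 1 0 = 0)
  (psi : M * ('rV[R]_k.-1 * R) -> R)
  (hpsi : forall p t s,
     expR (psi (p, (t, s))) = expR (h p) * expR (delta (enorm t)))
  (rho : M * ('rV[R]_k.-1 * R) -> R)
  (hrho : forall p t s, rho (p, (t, s)) = enorm t ^+ 2 - s ^+ 2)
  (Sig : set (M * ('rV[R]_k.-1 * R)))
  (hSig : hypersurface (prod_atlas A (eucl_atlas R k.-1)) Sig)
  (nu : chart (prod_atlas A (eucl_atlas R k.-1)) ->
        M * ('rV[R]_k.-1 * R) -> 'rV[R]_(n + (k.-1 + 1)))
  (hnu : unit_normal Sig nu)
  (hcompact : compact Sig) (hSconn : connected Sig)
  (hmin : psi_minimal psi Sig nu)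
  (r : R) (hr : 0 <= r)
  (hbd : hboundary (prod_atlas A (eucl_atlas R k.-1)) Sig
           `<=` [set q | rho q <= r ^+ 2]) :
  Sig `<=` [set q | rho q <= r ^+ 2].
Proof.
have l2 : (2 <= k.-1)%N by rewrite -ltnS prednK // (leq_trans _ hk).
have hrho' q : rho q = enorm q.2.1 ^+ 2 - q.2.2 ^+ 2 by case: q => p [t s].
move=> p0 Sp0 /=; have Sig0 : Sig !=set0 by exists p0.
(* The maximum [C] of [|t|^2] over [Sig] bounds the perturbation [eps |t|^2] by [eps * C], with [C]
   independent of [eps]. *)
have [c cS cmax] := compact_EVT_max Sig0 hcompact
  (continuous_subspaceT (@enorm_sqr_continuous R M k.-1)).
set C := enorm c.2.1 ^+ 2 in cmax.
have C0 : 0 <= C by exact: sqr_ge0.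
have bound eps : 0 < eps -> rho p0 <= r ^+ 2 + eps * C.
  move=> eps0; have [q qS qmax] := compact_EVT_max Sig0 hcompact
    (continuous_subspaceT (@perturbed_rho_continuous R M k.-1 eps)).
  have qmax' x : Sig x -> rho x + eps * enorm x.2.1 ^+ 2 <= rho q + eps * enorm q.2.1 ^+ 2.
    by move=> Sx; have := qmax x (mem_set Sx); rewrite !hrho' mulrDl mul1r; lra.
  have bq : hboundary (prod_atlas A (eucl_atlas R k.-1)) Sig q.
    apply: contrapT => nbq.
    have [b [D [X [pX [u Du Xu]]]]] := hSig q (set_mem qS).
    have DS x : D x -> Sig (X x).
      move=> Dx; have [_ [W oW XW] _ _ _] := pX.
      by have [] : (Sig `&` W) (X x) by rewrite -XW; exists x.
    (* A half-space patch reaches [q] off its face, since otherwise [q] would belong to the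
       boundary. *)
    have Du' : D° u.
      have [oD _ _ _ _] := pX; apply: (model_open_interior oD Du) => bT ubd.
      apply: nbq; exists D, X; split; last by exists u.
      by move: pX; rewrite (bT : b = true).
    have [_ /(_ (X u).1) [i iu] _ _ _] := hA.
    apply: (interior_max_absurd hA hdelta hdeltaC1 hpsi hnu hmin pX Du' iu eps0 l2).
    apply: filterS Du' => x Dx; rewrite Xu; apply: qmax; exact/mem_set/DS.
  have := qmax' p0 Sp0; have := hbd q bq; rewrite /=.
  have := cmax q qS; have p0N := sqr_ge0 (enorm p0.2.1).
  have := mulr_ge0 (ltW eps0) p0N.
  move=> ep0 qC rq; have : eps * enorm q.2.1 ^+ 2 <= eps * C by rewrite ler_pM2l.
  lra.
rewrite leNgt; apply/negP => d0.
(* This choice makes [eps * C] smaller than [rho p0 - r ^+ 2]; adding 1 to [C] keeps the denominator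
   positive. *)
pose eps := (rho p0 - r ^+ 2) / (2 * (C + 1)).
have C1 : 0 < 2 * (C + 1) by lra.
have eps0 : 0 < eps by rewrite divr_gt0 // subr_gt0.
have epsE : eps * (2 * (C + 1)) = rho p0 - r ^+ 2 by rewrite divfK ?gt_eqF.
have := bound _ eps0; have := mulr_ge0 (ltW eps0) C0; nra.
Qed.
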